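(* Let $g$ be an endomorphism of a finite-dimensional $\mathbb{F}_q$-vector space $V$. Assume that the type of $g$ is $((W_1,T_1),\dots,(W_s,T_s))$. Denote by $\delta_i$ the dimension of $W_i$, and by $\tau_i$ the sum of the coefficients in the table $T_i$. Then the number of Jordan-Hölder sequences of $g$ is $$\frac{(\tau_1+\cdots+\tau_s)!}{\tau_1!\cdots\tau_s!}\sum_{(\Gamma_1,\dots,\Gamma_s)}w(\Gamma_1)\cdots w(\Gamma_s),$$ the sum being taken over all the $s$-tuples $(\Gamma_1,\dots,\Gamma_s)$ where each $\Gamma_l$ is a sequence of admissible paths starting at $T_l$ and ending at the empty table.
   Context: A Jordan-Hölder sequence of $g$ is a maximal chain of $g$-invariant subspaces $0=V_0\subsetneq V_1\subsetneq\dots\subsetneq V_n=V$ (composition series of $V$ as an $\mathbb{F}_q[Y]$-module, $Y$ acting as $g$). Type of $g$: $W_1,\dots,W_s$ are the distinct isomorphism classes of irreducible invariant subspaces of $V$ (equivalently, $W_l\simeq\mathbb{F}_q[Y]/(\pi_l)$ with $\pi_1,\dots,\pi_s$ the distinct monic irreducible factors of the minimal polynomial of $g$, and $\delta_l=\deg\pi_l$). $V$ is the direct sum of its primary components $V_{(l)}$, where the minimal polynomial of $g$ on $V_{(l)}$ is a power of $\pi_l$. The table $T_l=(t_1,\dots,t_m)$, $t_1\ge\dots\ge t_m\ge1$, lists the lengths of the Jordan blocks of $g$ on $V_{(l)}$, i.e. $V_{(l)}\simeq\bigoplus_{j}\mathbb{F}_q[Y]/(\pi_l^{t_j})$. Admissible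 paths for a table $T=(t_1,\dots,t_m)$, with $t_1\ge\dots\ge t_m\ge 1$, attached to $W$ of dimension $\delta$: the $j$-th cell has coefficient $q^{\delta(j-1)}$ written above it. An admissible path from $T$ to another table is given by an index $i$ with $i=m$ or $t_i>t_{i+1}$, and transforms $T$ into the table obtained by replacing $t_i$ by $t_i-1$ (the last cell being deleted if $i=m$ and $t_m=1$). Its weight is the sum of the coefficients above the cells of $T$ containing the same number as the lowered cell, i.e. $\sum_{j:\,t_j=t_i}q^{\delta(j-1)}$. The weight $w(\Gamma)$ of a sequence $\Gamma=(\gamma_1,\dots,\gamma_\tau)$ of successive admissible paths is $\prod_k w(\gamma_k)$. *)

(* Defs.v *)
From HB Require Import structures.
From mathcomp Require Import all_boot all_order all_algebra.
From mathcomp Require Import zify.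

Set Implicit Arguments.
Unset Strict Implicit.
Unset Printing Implicit Defensive.

Import GRing.Theory.
Local Open Scope ring_scope.

Section Modules.

Variable F : fieldType.

Definition invariant (vT : vectType F) (g : 'End(vT)) (U : {vspace vT}) : bool :=
  (g @: U <= U)%VS.

(* (U, f) and (U', g) are isomorphic as F[Y]-modules, Y acting as f, resp. g;
   the subspaces may live in different ambient spaces. *)
Definition mod_iso (aT rT : vectType F) (f : 'End(aT)) (U : {vspace aT})
    (g : 'End(rT)) (U' : {vspace rT}) : Prop :=
  exists h : 'Hom(aT, rT),
    [/\ (U :&: lker h = 0)%VS, (h @: U = U')%VS
      & {in U, forall v, h (f v) = g (h v)}].

Definition mul_qX (p : {poly F}) : 'End({poly %/ p}) :=
  linfun (fun r : {poly %/ p} => 'qX * r).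

Lemma mul_qXE (p : {poly F}) (r : {poly %/ p}) : mul_qX p r = 'qX * r.
Proof.
have linM : linear (fun r : {poly %/ p} => 'qX * r).
  by move=> a u v; rewrite mulrDr scalerAr.
pose lin := GRing.isLinear.Build F {poly %/ p} {poly %/ p} *:%R
  (fun r : {poly %/ p} => 'qX * r) linM.
pose h : {linear {poly %/ p} -> {poly %/ p}} :=
  HB.pack (fun r : {poly %/ p} => 'qX * r) lin.
exact: (lfunE h r).
Qed.

Section Endomorphism.

Variables (vT : vectType F) (g : 'End(vT)).

(* U is isomorphic to F[Y]/(p).  The type {poly %/ p} is the intended quotient
   only for p monic and nonconstant, which holds wherever this is used. *)
Definition iso_cyclic (U : {vspace vT}) (p : {poly F}) : Prop :=
  mod_iso (mul_qX p) fullv g U.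

Definition irreducible_inv (U : {vspace vT}) : Prop :=
  [/\ invariant g U, U != 0%VS
    & forall U' : {vspace vT},
        invariant g U' -> (U' <= U)%VS -> U' = 0%VS \/ U' = U].

(* The endomorphism p(g).  'End(vT) has no canonical ring structure (vT may be
   zero), so that horner_alg is not available. *)
Definition lfun_horner (p : {poly F}) : 'End(vT) :=
  \sum_(i < size p) p`_i *: iter i (comp_lfun g) \1%VF.

Definition minpoly_on (U : {vspace vT}) (p : {poly F}) : Prop :=
  p \is monic /\
  forall r : {poly F}, (p %| r) <-> {in U, forall v, lfun_horner r v = 0}.

Definition table (t : seq nat) : bool := sorted geq t && (0%N \notin t).

(* U is an (internal) direct sum of submodules F[Y]/(pi^t_j). *)
Definition jordan_table (U : {vspace vT}) (pi : {poly F}) (t : seq nat) : Prop :=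
  table t /\
  exists B : 'I_(size t) -> {vspace vT},
    [/\ directv (\sum_j B j), (\sum_j B j)%VS = U
      & forall j, iso_cyclic (B j) (pi ^+ nth 0%N t j)].

Definition primary_decomposition (s : nat) (pi : 'I_s -> {poly F})
    (VP : 'I_s -> {vspace vT}) : Prop :=
  [/\ directv (\sum_l VP l), (\sum_l VP l)%VS = fullv
    & forall l, invariant g (VP l) /\ exists k, minpoly_on (VP l) (pi l ^+ k)].

(* Isomorphism classes of irreducible invariant subspaces are given by
   representatives W l. *)
Definition has_type (s : nat) (W : 'I_s -> {vspace vT})
    (T : 'I_s -> seq nat) : Prop :=
  [/\ forall l, irreducible_inv (W l),
      forall l l', mod_iso g (W l) g (W l') -> l = l',
      forall U, irreducible_inv U -> exists l, mod_iso g U g (W l)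
    & exists (pi : 'I_s -> {poly F}) (VP : 'I_s -> {vspace vT}),
      [/\ forall l, [/\ pi l \is monic, irreducible_poly (pi l)
                      & iso_cyclic (W l) (pi l)],
          primary_decomposition pi VP
        & forall l, jordan_table (VP l) (pi l) (T l)]].

Definition proper_subv (U U' : {vspace vT}) : bool :=
  (U <= U')%VS && (U != U').

(* Chains are listed increasingly as [:: V_0; ...; V_n]. *)
Definition inv_chain (C : seq {vspace vT}) : bool :=
  [&& all (invariant g) C, sorted proper_subv C,
      ohead C == Some 0%VS & last 0%VS C == fullv].

Definition jordan_holder (C : seq {vspace vT}) : Prop :=
  inv_chain C /\
  forall C', inv_chain C' -> {subset C <= C'} -> C' = C.

End Endomorphism.

End Modules.

Definition has_card (X : eqType) (P : X -> Prop) (n : nat) : Prop :=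
  exists L : seq X, [/\ uniq L, forall x, x \in L <-> P x & size L = n].

Local Open Scope nat_scope.

(* Cells of a table are numbered from 0, so the coefficient written above
   cell j is q ^ (delta * j). *)
Definition admissible (t : seq nat) (i : nat) : bool :=
  (i < size t) && ((i.+1 == size t) || (nth 0 t i.+1 < nth 0 t i)).

Definition lower_cell (t : seq nat) (i : nat) : seq nat :=
  if (i.+1 == size t) && (nth 0 t i == 1) then take i t
  else set_nth 0 t i (nth 0 t i).-1.

Definition step_weight (q delta : nat) (t : seq nat) (i : nat) : nat :=
  \sum_(j < size t | nth 0 t j == nth 0 t i) q ^ (delta * j).

(* A sequence of successive admissible paths starting at t is encoded by the
   list of the indices of the lowered cells. *)
Fixpoint path_end (t : seq nat) (G : seq nat) : option (seq nat) :=
  if G is i :: G' then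
    if admissible t i then path_end (lower_cell t i) G' else None
  else Some t.

Fixpoint path_weight (q delta : nat) (t : seq nat) (G : seq nat) : nat :=
  if G is i :: G' then
    step_weight q delta t i * path_weight q delta (lower_cell t i) G'
  else 1.

(* Every sequence of admissible paths from a table t to the empty table has
   length sumn t and only uses indices < size t, see [path_indicesP]. *)
Definition path_indices (t : seq nat) : finType :=
  (sumn t).-tuple 'I_(size t).

Definition indices (t : seq nat) (G : path_indices t) : seq nat :=
  [seq val i | i <- tval G].

Lemma lower_cell_table t i : table t -> admissible t i ->
  [/\ table (lower_cell t i), size (lower_cell t i) <= size t
    & sumn t = (sumn (lower_cell t i)).+1].
Proof.
move=> /andP[t_sorted t0] /andP[lt_it next].
have pos k : k < size t -> 0 < nth 0 t k.
  by rewrite lt0n => kt; apply: contra t0 => /eqP <-; apply: mem_nth.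
have ti_gt0 := pos _ lt_it.
rewrite /lower_cell; case: ifPn => [/andP[/eqP it /eqP ti1]|not_last].
  split; last 1 first.
  - rewrite -{1}(cat_take_drop i t) sumn_cat (drop_nth 0) // ti1 it drop_size.
    by rewrite /= addn1.
  - rewrite /table (subseq_sorted _ (take_subseq _ _) t_sorted) /=.
      by apply: contra t0 => /mem_take.
    by move=> x y z xy yz; apply: leq_trans yz xy.
  - by rewrite size_take lt_it ltnW.
split; last 1 first.
- rewrite sumn_set_nth lt_it.
  have : nth 0 t i <= sumn t.
    by rewrite -{2}(cat_take_drop i t) sumn_cat (drop_nth 0) //=; lia.
  lia.
- have szE : size (set_nth 0 t i (nth 0 t i).-1) = size t.
    by rewrite size_set_nth; lia.
  apply/andP; split.
    apply/(sortedP 0) => k; rewrite szE => kt; rewrite !nth_set_nth /=.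
    have /= := (sortedP 0 t_sorted) k kt.
    have := pos _ kt; have := pos _ (ltnW kt).
    have [ki|ki] := eqVneq k i.
      by rewrite -ki gtn_eqF //= => _ _ _; move: next; rewrite -ki; lia.
    by case: eqP => [<-|_]; lia.
  apply/(nthP 0) => -[k]; rewrite szE => kt; rewrite nth_set_nth /=.
  have := pos k kt; case: eqVneq => [-> _ tiE|_]; last by lia.
  have ti1 : nth 0 t i = 1 by lia.
  move: next not_last; rewrite ti1 eqxx andbT => /orP[-> //|].
  case: (ltngtP i.+1 (size t)) => // [lt_i1|]; last by lia.
  by have := pos _ lt_i1; lia.
- by rewrite size_set_nth; lia.
Qed.

Lemma path_indicesP t (G : seq nat) : table t ->
  path_end t G = Some [::] -> exists G' : path_indices t, indices G' = G.
Proof.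
move=> tab_t Gend.
suff [szG ltG] : size G = sumn t /\ all (fun i => i < size t) G.
  have GE : [seq val i | i <- pmap (@insub _ _ 'I_(size t)) G] = G.
    rewrite (pmap_filter (insubK _)) //; apply/all_filterP.
    by apply: sub_all ltG => i it; rewrite insubT.
  have sz' : size (pmap (@insub _ _ 'I_(size t)) G) == sumn t.
    by rewrite -szG -{2}GE size_map.
  by exists (Tuple sz').
elim: G t tab_t Gend => [|i G IH] t tab_t /=; first by case=> ->.
case: ifP => // adm_i Gend.
have [tab_t' le_size ->] := lower_cell_table tab_t adm_i.
have [-> ltG] := IH _ tab_t' Gend; split=> //.
have /andP[-> _] := adm_i.
by apply: sub_all ltG => k /leq_trans; apply.
Qed.

(* Main.v *)
Require Import Defs.
From HB Require Import structures.
From mathcomp Require Import all_boot all_order all_algebra all_field.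
From mathcomp Require Import zify ring.

(** Chains are counted upwards from an invariant subspace [A], starting at [A = 0]. Write
[X_k] for the set of [v] in [A + pi^k V] with [pi v] in [A], and [Q = q ^ deg pi]. The
quotient [X_k / A] is the part of the [pi]-socle of [V / A] lying in [pi^k (V / A)]; it is
a vector space over [F[Y]/(pi)] whose dimension is the number of cells [t_j > k]. An
invariant [B] covering [A], with [B / A] killed by [pi], is generated modulo [A] by any of
its vectors outside [A]; hence counting vectors, exactly [(Q^a - Q^b) / (Q - 1)] of them lie
in [X_(k-1)] but not in [X_k], where [a] and [b] count the cells [>= k] and [> k]. This is
the weight of lowering the last cell equal to [k], and comparing the images [pi^k V + B]
with [pi^k V + A] shows that [V / B] has the table lowered in this way. So the number of
chains depends only on the tables and obeys the same recursion as the claimed formula. *)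

Set Implicit Arguments.
Unset Strict Implicit.
Unset Printing Implicit Defensive.

Import GRing.Theory Num.Theory.
Local Open Scope ring_scope.

(* [invariant] alone would denote [eqtype.invariant]. *)
Local Notation invariant := Defs.invariant.

(** * Polynomials in [g], and the submodule generated by one vector *)

Section LfunHorner.

Variables (F : fieldType) (vT : vectType F) (g : 'End(vT)).
Implicit Types (p q r : {poly F}) (v w : vT) (A U : {vspace vT}).

Local Notation ev p := (lfun_horner g p).

Lemma lfun_horner_wide p n v : (size p <= n)%N ->
  ev p v = \sum_(i < n) p`_i *: iter i g v.
Proof.
move=> le_pn; rewrite /lfun_horner sum_lfunE.
have itE i w : iter i (comp_lfun g) \1%VF w = iter i g w.
  by elim: i => [|i IH] /=; rewrite ?id_lfunE // comp_lfunE IH.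
under eq_bigr do rewrite scale_lfunE itE.
rewrite (big_ord_widen n (fun i => p`_i *: iter i g v) le_pn) big_mkcond /=.
apply: eq_bigr => i _; case: ltnP => // le_pi.
by rewrite nth_default // scale0r.
Qed.

Lemma lfun_horner_poly n (c : nat -> F) v :
  ev (\poly_(i < n) c i) v = \sum_(i < n) c i *: iter i g v.
Proof.
rewrite (lfun_horner_wide _ (size_poly _ _)); apply: eq_bigr => i _.
by rewrite coef_poly ltn_ord.
Qed.

Lemma lfun_hornerD p q v : ev (p + q) v = ev p v + ev q v.
Proof.
pose n := maxn (size p) (size q).
rewrite (@lfun_horner_wide _ n) ?size_polyD //.
rewrite (@lfun_horner_wide p n) ?leq_maxl // (@lfun_horner_wide q n) ?leq_maxr //.
by rewrite -big_split; apply: eq_bigr => i _; rewrite coefD scalerDl.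
Qed.

Lemma lfun_hornerZ a p v : ev (a *: p) v = a *: ev p v.
Proof.
rewrite (@lfun_horner_wide _ (size p)) ?size_scale_leq //.
rewrite (@lfun_horner_wide p (size p)) // scaler_sumr.
by apply: eq_bigr => i _; rewrite coefZ scalerA.
Qed.

Lemma lfun_hornerC a v : ev a%:P v = a *: v.
Proof.
by rewrite (@lfun_horner_wide _ 1) ?size_polyC_leq1 // big_ord1 coefC.
Qed.

Lemma lfun_horner1 v : ev 1 v = v.
Proof. by rewrite lfun_hornerC scale1r. Qed.

Lemma lfun_horner0 v : ev 0 v = 0.
Proof. by rewrite lfun_hornerC scale0r. Qed.

Lemma lfun_hornerXM p v : ev (p * 'X) v = ev p (g v).
Proof.
have le_sz : (size (p * 'X)%R <= (size p).+1)%N.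
  by apply: leq_trans (size_polyMleq _ _) _; rewrite size_polyX addn2.
rewrite (lfun_horner_wide _ le_sz) (lfun_horner_wide _ (leqnn _)).
rewrite big_ord_recl coefMX /= scale0r add0r.
by apply: eq_bigr => i _; rewrite coefMX /= -iterSr.
Qed.

Lemma lfun_hornerX v : ev 'X v = g v.
Proof. by rewrite -['X]mul1r lfun_hornerXM lfun_horner1. Qed.

Lemma lfun_horner_comm p v : ev p (g v) = g (ev p v).
Proof.
rewrite !(lfun_horner_wide _ (leqnn _)) linear_sum.
by apply: eq_bigr => i _; rewrite linearZ -iterSr.
Qed.

Lemma lfun_hornerM p q v : ev (p * q) v = ev p (ev q v).
Proof.
elim/poly_ind: p v => [|p c IH] v; first by rewrite mul0r !lfun_horner0.
rewrite mulrDl (mulrAC p) 2!lfun_hornerD !lfun_hornerXM IH.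
by rewrite mul_polyC lfun_hornerZ lfun_hornerC lfun_horner_comm.
Qed.

Lemma lfun_hornerMC p q v : ev p (ev q v) = ev q (ev p v).
Proof. by rewrite -!lfun_hornerM mulrC. Qed.

Lemma invariantP U : reflect {in U, forall v, g v \in U} (invariant g U).
Proof.
apply: (iffP subvP) => [gU v Uv | gU _ /memv_imgP[v Uv ->]].
  by apply: gU; apply: memv_img.
exact: gU.
Qed.

Lemma invariant_horner U p : invariant g U -> {in U, forall v, ev p v \in U}.
Proof.
move=> /invariantP gU v Uv; rewrite (lfun_horner_wide _ (leqnn _)).
apply: memv_suml => i _; apply: memvZ.
by elim: (i : nat) => //= k; apply: gU.
Qed.

Lemma invariant_cap U A : invariant g U -> invariant g A -> invariant g (U :&: A).
Proof.
move=> /invariantP gU /invariantP gA; apply/invariantP => v.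
by rewrite !memv_cap => /andP[/gU-> /gA].
Qed.

Lemma invariant_add U A : invariant g U -> invariant g A -> invariant g (U + A).
Proof. by move=> gU gA; rewrite /invariant limgD addvS. Qed.

Lemma invariant0 : invariant g 0.
Proof. by rewrite /invariant limg0 sub0v. Qed.

Lemma invariantf : invariant g fullv.
Proof. exact: subvf. Qed.

Lemma invariant_limg p U : invariant g U -> invariant g (ev p @: U).
Proof.
move=> /invariantP gU; apply/invariantP => _ /memv_imgP[v Uv ->].
by rewrite -lfun_horner_comm memv_img ?gU.
Qed.

Lemma invariant_preim p A : invariant g A -> invariant g (ev p @^-1: A).
Proof.
move=> /invariantP gA; apply/invariantP => v.
by rewrite -!memv_preim lfun_horner_comm => /gA.
Qed.

Lemma sub_preim p A : invariant g A -> (A <= ev p @^-1: A)%VS.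
Proof. by move=> gA; apply/subvP => v Av; rewrite -memv_preim invariant_horner. Qed.

Lemma coprimep_horner_mem p q A v : coprimep p q -> invariant g A ->
  ev p v \in A -> ev q v \in A -> v \in A.
Proof.
move=> /Bezout_eq1_coprimepP[[a b] /= ab1] gA pv qv.
rewrite -(lfun_horner1 v) -ab1 lfun_hornerD !lfun_hornerM.
by apply: memvD; apply: invariant_horner.
Qed.

(** Only [n] iterates are spanned, so this need not be invariant. It becomes so after adding an
    invariant [A] that contains [r(g) v], where [r] is nonzero of degree [n]. *)
Definition cyc n v : {vspace vT} := <<[tuple iter i g v | i < n]>>%VS.

Lemma cycP n v w :
  reflect (exists2 p : {poly F}, (size p <= n)%N & w = ev p v) (w \in cyc n v).
Proof.
apply: (iffP idP) => [/coord_span-> | [p szp ->]].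
  set c := coord _; exists (\poly_(i < n) (if insub i is Some j then c j w else 0)).
    exact: size_poly.
  rewrite lfun_horner_poly; apply: eq_bigr => i _.
  by rewrite valK -tnth_nth tnth_mktuple.
rewrite (lfun_horner_wide _ szp); apply: memv_suml => i _; apply/memvZ/memv_span.
by rewrite -(tnth_mktuple (fun i : 'I_n => iter i g v) i) mem_tnth.
Qed.

Section AddCyclic.

Variables (A : {vspace vT}) (v : vT) (r : {poly F}).
Hypotheses (gA : invariant g A) (r_neq0 : r != 0) (rv : ev r v \in A).

(** Divide by [r]: the multiple of [r] sends [v] into [A], and the remainder uses only the iterates
    in [cyc]. *)
Lemma mem_add_cyc p : ev p v \in (A + cyc (size r).-1 v)%VS.
Proof.
rewrite (divp_eq p r) lfun_hornerD lfun_hornerM; apply: memv_add.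
  exact: invariant_horner.
apply/cycP; exists (p %% r) => //.
by rewrite -ltnS prednK ?lt0n ?size_poly_eq0 // ltn_modp.
Qed.

Lemma mem_gen_add_cyc : v \in (A + cyc (size r).-1 v)%VS.
Proof. by have := mem_add_cyc 1; rewrite lfun_horner1. Qed.

Lemma invariant_add_cyc : invariant g (A + cyc (size r).-1 v).
Proof.
apply/invariantP => _ /memv_addP[a Aa [_ /cycP[p _ ->] ->]].
rewrite linearD; apply: memvD.
  by apply: (subvP (addvSl _ _)); apply: (invariantP _ gA).
by rewrite /= -lfun_hornerX -lfun_hornerM mem_add_cyc.
Qed.

Lemma add_cyc_sub U : invariant g U -> (A <= U)%VS -> v \in U ->
  (A + cyc (size r).-1 v <= U)%VS.
Proof.
move=> gU sAU Uv; rewrite subv_add sAU; apply/subvP => _ /cycP[p _ ->].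
exact: invariant_horner.
Qed.

(** A linear relation between these iterates modulo [A] is a polynomial of smaller degree than [r]
    sending [v] into [A]; being divisible by [r], it is zero. This gives both the freeness of the
    iterates and the trivial intersection with [A]. *)
Lemma dim_add_cyc : (forall p : {poly F}, ev p v \in A -> r %| p) ->
  \dim (A + cyc (size r).-1 v) = (\dim A + (size r).-1)%N.
Proof.
move=> ann.
have small p : (size p <= (size r).-1)%N -> ev p v \in A -> p = 0.
  move=> szp /ann r_p; apply/eqP; apply: contraT => p0.
  have := dvdp_leq p0 r_p.
  by rewrite leqNgt (leq_ltn_trans szp) // prednK ?lt0n ?size_poly_eq0.
rewrite dimv_disjoint_sum.
  congr (_ + _)%N; apply/eqP.
  rewrite -[X in _ == X](size_tuple [tuple iter i g v | i < (size r).-1]).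
  apply/freeP => k sum0 i.
  pose c j := if insub j is Some j' then k j' else 0.
  have cE (j : 'I_(size r).-1) : c j = k j.
    by rewrite /c valK.
  have : \poly_(j < (size r).-1) c j = 0.
    apply: small; first exact: size_poly.
    rewrite lfun_horner_poly (_ : \sum_(j < _) _ = 0) ?mem0v // -[RHS]sum0.
    by apply: eq_bigr => j _; rewrite cE -tnth_nth tnth_mktuple.
  by move=> /polyP/(_ i); rewrite coef_poly ltn_ord cE coef0.
apply/eqP; rewrite -subv0; apply/subvP => w; rewrite memv_cap memv0.
by move=> /andP[Aw /cycP[p szp wE]]; rewrite wE (small p) ?lfun_horner0 // -wE.
Qed.

End AddCyclic.

End LfunHorner.

(** * Minimal invariant subspaces above a given one *)

Section Covers.

Variables (F : fieldType) (vT : vectType F) (g : 'End(vT)).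
Implicit Types (p q r : {poly F}) (v w : vT) (A B U X : {vspace vT}).

Local Notation ev p := (lfun_horner g p).

(** On [U] and on its part [W] sent into [A], [f] has the same kernel, and it maps [W] onto the
    intersection of [A] and [f @: U]. Rank-nullity, used twice, and the dimension formula for a sum
    conclude. *)
Lemma dim_cap_preim (f : 'End(vT)) A U :
  (\dim (U :&: (f @^-1: A)) + \dim (A + f @: U) = \dim A + \dim U)%N.
Proof.
pose W := (U :&: (f @^-1: A))%VS.
have WE : (f @: W = A :&: (f @: U))%VS.
  apply/vspaceP => w; rewrite memv_cap; apply/memv_imgP/andP.
    by case=> v; rewrite memv_cap -memv_preim => /andP[Uv Afv] ->; rewrite memv_img.
  by case=> Aw /memv_imgP[v Uv wE]; exists v; rewrite // memv_cap Uv -memv_preim -wE.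
have kerE : (W :&: lker f = U :&: lker f)%VS.
  apply/vspaceP => v; rewrite !memv_cap -memv_preim memv_ker.
  by case: eqP => [->|]; rewrite ?andbF // mem0v !andbT.
have := limg_ker_dim f W; have := limg_ker_dim f U.
have := dimv_sum_cap A (f @: U)%VS; rewrite kerE WE -/W; lia.
Qed.

(** For invariant [A], this says that [B / A] is a simple module. *)
Definition inv_cover A B : Prop :=
  [/\ invariant g B, (A <= B)%VS, A != B
    & forall U, invariant g U -> (A <= U)%VS -> (U <= B)%VS -> U = A \/ U = B].

Lemma cover_witness A B : inv_cover A B -> exists2 v, v \in B & v \notin A.
Proof.
case=> _ sAB neqAB _; apply/subvPn; apply: contra neqAB => sBA.
by rewrite eqEsubv sAB.
Qed.

Lemma cover_cap A B U : invariant g A -> inv_cover A B -> invariant g U ->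
  (A <= U)%VS -> ~~ (B <= U)%VS -> (B :&: U)%VS = A.
Proof.
move=> gA [gB sAB _ minB] gU sAU nBU.
have [] // := minB (B :&: U)%VS (invariant_cap gB gU).
- by rewrite subv_cap sAB.
- exact: capvSl.
by move=> E; case/negP: nBU; rewrite -E capvSr.
Qed.

Section Irreducible.

Variable (pi : {poly F}) (A : {vspace vT}).
Hypotheses (irr_pi : irreducible_poly pi) (gA : invariant g A).

Let delta := (size pi).-1.

Let pi_neq0 : pi != 0. Proof. exact: irredp_neq0 irr_pi. Qed.

Lemma delta_gt0 : (0 < delta)%N.
Proof. by case: irr_pi; rewrite /delta; case: (size pi) => [|[]]. Qed.

Lemma irreducible_ann v p : ev pi v \in A -> v \notin A -> ev p v \in A -> pi %| p.
Proof.
move=> piv nAv pv; apply: contraNT nAv => npip.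
by apply: (coprimep_horner_mem _ gA piv pv); rewrite irreducible_poly_coprime.
Qed.

Lemma dim_irr_add_cyc v : ev pi v \in A -> v \notin A ->
  \dim (A + cyc g delta v) = (\dim A + delta)%N.
Proof.
move=> piv nAv; apply: dim_add_cyc => // p; exact: irreducible_ann.
Qed.

(** A vector of an intermediate [U] outside [A] is again killed by [pi] modulo [A], so it generates
    over [A] a subspace of the same dimension, which must be everything. *)
Lemma cover_add_cyc v : ev pi v \in A -> v \notin A -> inv_cover A (A + cyc g delta v).
Proof.
move=> piv nAv; have Bv := mem_gen_add_cyc gA pi_neq0 piv.
split; first exact: invariant_add_cyc.
- exact: addvSl.
- by apply: contraNneq nAv => ->.
move=> U gU sAU sUB; have [sUA | /subvPn[u Uu nAu]] := boolP (U <= A)%VS.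
  by left; apply/eqP; rewrite eqEsubv sUA.
right; have piu : ev pi u \in A.
  have /subvP sB : (A + cyc g delta v <= ev pi @^-1: A)%VS.
    apply: add_cyc_sub; rewrite ?invariant_preim ?sub_preim //.
    by rewrite -memv_preim.
  by rewrite memv_preim; apply/sB/(subvP sUB).
apply/eqP; rewrite eqEdim sUB dim_irr_add_cyc // -(dim_irr_add_cyc piu nAu).
exact: dimvS (add_cyc_sub _ gU sAU Uu).
Qed.

Lemma coverE B v : inv_cover A B -> v \in B -> ev pi v \in A -> v \notin A ->
  B = (A + cyc g delta v)%VS.
Proof.
case=> gB sAB _ minB Bv piv nAv.
have [gC sAC neqAC _] := cover_add_cyc piv nAv.
have [] // := minB _ gC sAC (add_cyc_sub pi gB sAB Bv).
by move=> E; rewrite E eqxx in neqAC.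
Qed.

Lemma dim_cover B : inv_cover A B -> (B <= ev pi @^-1: A)%VS ->
  \dim B = (\dim A + delta)%N.
Proof.
move=> covB /subvP sBK; have [v Bv nAv] := cover_witness covB.
have piv : ev pi v \in A by rewrite memv_preim sBK.
by rewrite (coverE covB Bv piv nAv) dim_irr_add_cyc.
Qed.

Lemma cover_coprime_disj B p : coprimep pi p -> inv_cover A B ->
  (B <= ev pi @^-1: A)%VS -> (B <= ev p @^-1: A)%VS -> False.
Proof.
move=> co covB /subvP s1 /subvP s2; have [v Bv] := cover_witness covB.
by rewrite (coprimep_horner_mem co gA) // memv_preim ?s1 ?s2.
Qed.

(** [dim_cap_preim] applies to [pi ^+ k] on the [pi ^+ k.+1]-torsion modulo [A]: its image, added to
    [A], is the part of the [pi]-socle of the quotient lying in the image of [pi ^+ k]. Socle layers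
    are thus measured by differences of torsion dimensions. *)
Lemma dim_socle_layer k :
  (\dim ((ev (pi ^+ k.+1) @^-1: A) :&: (ev (pi ^+ k) @^-1: A))
   + \dim ((ev pi @^-1: A) :&: (A + limg (ev (pi ^+ k))))
   = \dim A + \dim (ev (pi ^+ k.+1) @^-1: A))%N.
Proof.
set f := ev (pi ^+ k); rewrite -(dim_cap_preim f A (ev (pi ^+ k.+1) @^-1: A)).
congr (_ + \dim _)%N; apply/vspaceP => w; rewrite memv_cap -memv_preim.
apply/andP/memv_addP.
  case=> piw /memv_addP[a Aa [_ /memv_imgP[v _ ->] wE]].
  exists a => //; exists (f v) => //; apply: memv_img.
  rewrite -memv_preim exprS lfun_hornerM.
  have -> : ev (pi ^+ k) v = w - a by rewrite wE addrAC subrr add0r.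
  by rewrite linearB memvB //= invariant_horner.
case=> a Aa [_ /memv_imgP[v Kv ->] ->]; split; last first.
  by apply: memv_add => //; rewrite memv_img ?memvf.
rewrite linearD memvD //=; first exact: invariant_horner.
by rewrite -lfun_hornerM -exprS memv_preim.
Qed.

Lemma preim_exprS k : (ev (pi ^+ k) @^-1: A <= ev (pi ^+ k.+1) @^-1: A)%VS.
Proof.
by apply/subvP => v; rewrite -!memv_preim exprS lfun_hornerM; apply: invariant_horner.
Qed.

End Irreducible.

Section CoverImage.

Variables (pi : {poly F}) (A B : {vspace vT}).
Hypotheses (irr_pi : irreducible_poly pi) (gA : invariant g A).
Hypotheses (covB : inv_cover A B) (sBK : (B <= ev pi @^-1: A)%VS).

Lemma dim_limg_add_cover_sub p : (B <= A + limg (ev p))%VS ->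
  \dim (limg (ev p) + B) = \dim (limg (ev p) + A).
Proof.
case: covB => _ sAB _ _ sB; rewrite addvC in sB; apply/eqP.
by rewrite eqn_leq !dimvS //; [exact: addvS | rewrite subv_add addvSl].
Qed.

(** By minimality [B] meets [A + limg (ev p)] only in [A], so all of [B / A] is added. *)
Lemma dim_limg_add_cover p : ~~ (B <= A + limg (ev p))%VS ->
  \dim (limg (ev p) + B) = (\dim (limg (ev p) + A) + (size pi).-1)%N.
Proof.
move=> nB; have [gB sAB _ _] := covB.
have := cover_cap gA covB _ (addvSl _ _) nB.
move/(_ (invariant_add gA (invariant_limg _ (invariantf g)))) => capE.
have := dimv_sum_cap B (A + limg (ev p)); rewrite capE.
rewrite addvA (addv_idPl sAB) (addvC B) (addvC A).
rewrite (dim_cover irr_pi gA covB sBK); lia.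
Qed.

(** As [pi] kills [B / A], Bezout makes a coprime [p] act invertibly there. *)
Lemma cover_sub_coprime p : coprimep pi p -> (B <= A + limg (ev p))%VS.
Proof.
move=> /Bezout_eq1_coprimepP[[a b] /= ab1]; apply/subvP => w /(subvP sBK).
rewrite -memv_preim => piw.
rewrite -(lfun_horner1 g w) -ab1 lfun_hornerD lfun_hornerM; apply: memv_add.
  exact: invariant_horner.
by rewrite mulrC lfun_hornerM memv_img ?memvf.
Qed.

End CoverImage.

End Covers.

(** * Combinatorics of tables and weights *)

Section Tables.

Local Open Scope nat_scope.
Implicit Types t : seq nat.

(** For a [pi]-primary module with table [t], this times the degree of [pi] is the dimension of the
    kernel of [pi ^+ k]. *)
Definition truncated_sum t k := sumn [seq minn x k | x <- t].

Lemma truncated_sumS t k : truncated_sum t k.+1 = truncated_sum t k + count (ltn k) t.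
Proof. by elim: t => //= x t; rewrite /truncated_sum /=; lia. Qed.

Lemma count_gt_sumn t : count (ltn (sumn t)) t = 0.
Proof.
apply/eqP; rewrite eqn0Ngt -has_count; apply/hasPn => x xt.
rewrite -leqNgt; elim: t xt => //= y t IH; rewrite inE => /orP[/eqP->|/IH]; lia.
Qed.

Lemma table_nth_gt0 t i : table t -> i < size t -> 0 < nth 0 t i.
Proof.
by case/andP=> _ t0 lt_i; rewrite lt0n; apply: contraNneq t0 => <-; apply: mem_nth.
Qed.

Lemma table_nth_leq t i j : table t -> i <= j -> nth 0 t j <= nth 0 t i.
Proof.
case/andP=> st _ le_ij; have [le_sz|lt_j] := leqP (size t) j.
  by rewrite nth_default.
apply: (sorted_leq_nth _ _ _ st); rewrite ?inE //=; last exact: leq_ltn_trans lt_j.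
  by move=> y x z /= yx zy; apply: leq_trans zy yx.
by move=> x /=; apply: leqnn.
Qed.

(** An admissible cell is the last among the cells with its value. *)
Lemma admissible_inj t i j : table t -> admissible t i -> admissible t j ->
  nth 0 t i = nth 0 t j -> i = j.
Proof.
move=> tab; wlog lt_ij : i j / i < j.
  move=> W ai aj E; case: (ltngtP i j) => // lt; first exact: W.
  by apply/esym/W.
case/andP=> lti ai /andP[ltj _] E.
have := table_nth_leq tab lt_ij; rewrite -E => le.
by case/orP: ai => [/eqP|]; lia.
Qed.

Lemma admissible_exists t x : table t -> x \in t ->
  exists2 i, admissible t i & nth 0 t i = x.
Proof.
elim: t => // y t IH tab; have [xt _|nxt] := boolP (x \in t).
  have tab_t : table t.
    case/andP: tab => /= /path_sorted st; rewrite inE negb_or => /andP[_ t0].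
    exact/andP.
  by have [i adm E] := IH tab_t xt; exists i.+1.
rewrite inE (negPf nxt) orbF => /eqP xy; rewrite -xy in tab *; exists 0 => //.
rewrite /admissible /=; case: t nxt tab {IH} => //= z t.
rewrite inE negb_or => /andP[neq _] /andP[/= /andP[le _] _].
have ltzx : z < x by rewrite ltn_neqAle eq_sym neq.
by rewrite ltzx ?orbT.
Qed.

(** Replacing a positive [x] by [x.-1] changes [minn x k] only when [x <= k], and then by one. *)
Lemma truncated_sum_lower t i k : table t -> admissible t i ->
  truncated_sum (lower_cell t i) k + (nth 0 t i <= k) = truncated_sum t k.
Proof.
move=> tab adm; have ti := table_nth_gt0 tab (proj1 (andP adm)).
have lti := proj1 (andP adm).
have split u : truncated_sum (take i t ++ u :: drop i.+1 t) k =
    truncated_sum (take i t) k + minn u k + truncated_sum (drop i.+1 t) k.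
  by rewrite /truncated_sum map_cat sumn_cat /= addnA.
have tE : t = take i t ++ nth 0 t i :: drop i.+1 t.
  by rewrite -drop_nth // cat_take_drop.
rewrite [in RHS]tE split /lower_cell; case: ifP => [/andP[/eqP it /eqP ->]|_].
  by rewrite it drop_size /truncated_sum /=; lia.
by rewrite set_nthE lti split; lia.
Qed.

(** In a sorted table equal cells occupy consecutive positions, so the weight is a geometric sum of
    ratio [q ^ delta]. The closed form is written additively to avoid truncated subtraction. *)
Lemma step_weight_mul q delta t i : 0 < q -> table t -> admissible t i ->
  step_weight q delta t i * (q ^ delta).-1 + (q ^ delta) ^ count (ltn (nth 0 t i)) t
  = (q ^ delta) ^ count (ltn (nth 0 t i).-1) t.
Proof.
move=> q0 tab adm; have := table_nth_gt0 tab (proj1 (andP adm)).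
(* Only positivity of the value is kept, so that the induction also covers tables in which it does
   not occur. *)
rewrite /step_weight; move: (nth 0 t i) => v v0.
have Q0 : 0 < q ^ delta by rewrite expn_gt0 q0.
rewrite (eq_bigr (fun j : 'I_(size t) => (q ^ delta) ^ j)); last first.
  by move=> j _; rewrite expnM.
case: (q ^ delta) Q0 => //= Q _.
have st : sorted geq t by case/andP: tab.
(* Deleting the last cell, a smallest one, keeps the positions and so the coefficients of the
   others. *)
elim/last_ind: t st {tab adm} => [|t x IH] st; first by rewrite big_ord0.
have geqT : transitive geq by move=> y z u /= zy uy; apply: leq_trans uy zy.
have := st; rewrite sorted_pairwise // pairwise_rcons -sorted_pairwise //.
move=> /andP[/allP tx st'].
rewrite size_rcons big_mkcond big_ord_recr /= nth_rcons ltnn eqxx.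
under eq_bigr => j _ do rewrite nth_rcons ltn_ord.
rewrite -big_mkcond /= -cats1 !count_cat /= !addn0.
have cnt u : u < x -> count (ltn u) t = size t.
  move=> ux; apply/eqP; rewrite -all_count; apply/allP => y /tx /=; lia.
have {IH}IH := IH st'.
case: eqP => [xv|xv].
  have c1 : count (ltn v.-1) t = size t by apply: cnt; lia.
  have ltvx : (v < x) = false by lia.
  have ltv1x : (v.-1 < x) = true by lia.
  rewrite c1 in IH *; rewrite ltvx ltv1x addn0 addn1 mulnDl addnAC IH expnS.
  by rewrite mulSn mulnC.
rewrite addn0.
have [ltvx|] := ltnP v x; last first.
  move=> le; have -> : (v.-1 < x) = false by lia.
  by rewrite !addn0.
have -> : (v.-1 < x) = true by lia.
have c1 : count (ltn v.-1) t = size t by apply: cnt; lia.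
have c2 : count (ltn v) t = size t by apply: cnt; lia.
rewrite c1 c2 addn1 in IH *.
suff -> : \sum_(j < size t | nth 0 t j == v) Q.+1 ^ j = 0 by [].
rewrite big1 // => j /eqP jv; have := tx _ (mem_nth 0 (ltn_ord j)) => /=; lia.
Qed.

(** The sum of the weights of all sequences of [n] admissible paths from [t] to the empty table,
    organised by the first path. *)
Fixpoint total_weight q delta n t : nat :=
  if n is m.+1 then
    \sum_(i < size t | admissible t i)
      step_weight q delta t i * total_weight q delta m (lower_cell t i)
  else t == [::].

Lemma size_lower_cell t i : i < size t -> size (lower_cell t i) <= size t.
Proof.
move=> lti; rewrite /lower_cell; case: ifP => _; first by rewrite size_take lti ltnW.
by rewrite size_set_nth; lia.
Qed.

Lemma big_tuple_cons (T : finType) n (P : pred (n.+1.-tuple T)) (f : n.+1.-tuple T -> nat) :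
  \sum_(G | P G) f G =
  \sum_x \sum_(G : n.-tuple T | P [tuple of x :: G]) f [tuple of x :: G].
Proof.
rewrite (reindex (fun xG : T * n.-tuple T => [tuple of xG.1 :: xG.2])) /=.
  by rewrite pair_big_dep.
apply: onW_bij; exists (fun G => (thead G, [tuple of behead G])).
  by case=> x G /=; rewrite theadE; congr (_, _); apply: val_inj.
by move=> G /=; rewrite -tuple_eta.
Qed.

(** The index type ['I_N] stays fixed while the table shrinks along the recursion, hence a bound on
    the size instead of the size itself. *)
Lemma sum_path_weight q delta n N t : size t <= N ->
  \sum_(G : n.-tuple 'I_N | path_end t [seq val i | i <- G] == Some [::])
     path_weight q delta t [seq val i | i <- G] = total_weight q delta n t.
Proof.
elim: n t => [|n IH] t szt.
  rewrite big_mkcond (bigD1 [tuple]) //= big1 => [|G]; last by rewrite tuple0.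
  by rewrite addn0 (inj_eq (@Some_inj _)); case: eqP.
rewrite big_tuple_cons /=.
rewrite (big_ord_widen_cond _ (admissible t)
  (fun i => step_weight q delta t i * total_weight q delta n (lower_cell t i)) szt).
rewrite [RHS]big_mkcond; apply: eq_bigr => i _ /=.
rewrite -[_ && _]andbC; have [/andP[lti _]|nadm] := boolP (admissible t i); last first.
  by rewrite big1 ?andbF.
rewrite lti /= -big_distrr /=; congr (_ * _); apply: IH.
exact: leq_trans (size_lower_cell lti) szt.
Qed.

(** Distributivity for dependent families; replacing the terms outside [Q] by 0 lets the sum run
    over all of them. *)
Lemma sum_dffun_prod (I : finType) (T_ : I -> finType)
    (Q : forall i, pred (T_ i)) (f : forall i, T_ i -> nat) :
  \sum_(G : {dffun forall i, T_ i} | [forall i, Q i (G i)]) \prod_i f i (G i)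
  = \prod_i \sum_(x : T_ i | Q i x) f i x.
Proof.
pose P i := [ffun x : T_ i => if Q i x then f i x else 0].
transitivity (\sum_(G : {dffun forall i, T_ i}) \prod_i P i (G i)).
  rewrite big_mkcond; apply: eq_bigr => G _; case: forallP => [QG|/forallP].
    by apply: eq_bigr => i _; rewrite ffunE QG.
  rewrite negb_forall => /existsP[i nQ].
  by rewrite (bigD1 i) //= ffunE (negPf nQ).
rewrite (reindex (@dffun_of_fprod I T_)) /=; last exact/onW_bij/dffun_of_fprod_bij.
transitivity (\sum_(G : fprod T_) \prod_(i in I) P i (G i)).
  by apply: eq_bigr => G _; apply: eq_bigr => i _; congr (P i _); rewrite ffunE.
rewrite big_fprod.
rewrite -(bigA_distr_big_dep (fun i => tagged_with T_ i) (fun i => untag 0 (P i))) /=.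
apply: eq_bigr => i _.
rewrite -(big_tag (fun i x => P i x)) [RHS]big_mkcond.
by apply: eq_bigr => x _; rewrite ffunE.
Qed.

End Tables.

(** * Enumerating chains and counting covers over a finite field *)

Lemma card_memv (F : finFieldType) (vT : vectType F) (U : {vspace vT}) :
  #|[pred v : finvect_type vT | v \in U]| = (#|F| ^ \dim U)%N.
Proof.
case: vT U => T cT U.
pose fT : finType := finvect_type (Vector.Pack cT).
have := @card_vspace F fT cT U.
by move=> <-; apply: eq_card => v; rewrite inE.
Qed.

Section Chains.

Variables (F : finFieldType) (vT : vectType F) (g : 'End(vT)).
Implicit Types (A B U X : {vspace vT}) (c C : seq {vspace vT}).

(** Different matrices may define the same subspace, hence [undup]. *)
Definition subspaces : seq {vspace vT} :=
  undup [seq VectorInternalTheory.mx2vs M | M : 'M[F]_(dim vT)].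

Lemma mem_subspaces U : U \in subspaces.
Proof.
rewrite mem_undup -[U]VectorInternalTheory.vs2mxK.
by apply/mapP; exists (VectorInternalTheory.vs2mx U); rewrite ?mem_enum.
Qed.

Definition coverb : rel {vspace vT} := fun A B =>
  [&& invariant g B, (A <= B)%VS, A != B
    & all (fun U => [&& invariant g U, A <= U & U <= B]%VS ==> (U == A) || (U == B))
          subspaces].

Lemma coverP A B : reflect (inv_cover g A B) (coverb A B).
Proof.
apply: (iffP and4P) => [[gB sAB nAB /allP min]|[gB sAB nAB min]]; split => //.
  move=> U gU sAU sUB; have := min U (mem_subspaces U).
  by rewrite gU sAU sUB => /orP[] /eqP; [left | right].
apply/allP => U _; apply/implyP => /and3P[gU sAU sUB].
by case: (min U gU sAU sUB) => ->; rewrite eqxx ?orbT.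
Qed.

Lemma proper_subv_trans : transitive (@proper_subv F vT).
Proof.
move=> B A U /andP[sAB nAB] /andP[sBU nBU]; rewrite /proper_subv (subv_trans sAB) //=.
by apply: contraNneq nBU => AU; rewrite eqEsubv sBU -AU.
Qed.

Lemma coverb_proper A B : coverb A B -> proper_subv A B.
Proof. by case/and4P=> _ sAB nAB _; apply/andP. Qed.

(** A step that is not a cover has an invariant subspace strictly between its ends, which can be
    inserted. *)
Lemma path_refine A c : all (invariant g) c -> path (@proper_subv F vT) A c ->
  ~~ path coverb A c ->
  exists c', [/\ all (invariant g) c', path (@proper_subv F vT) A c',
                 last A c' = last A c, {subset c <= c'} & c' != c].
Proof.
elim: c A => //= B c IH A /andP[gB gc] /andP[pAB pc].
rewrite negb_and orbC.
have [pathc /= | /(IH _ gc pc) [c' [gc' pc' lc' sc' nc']] _] := boolP (path _ _ _);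
  last first.
  exists (B :: c'); split => //=; rewrite ?gB ?pAB //.
    by move=> U; rewrite !inE => /orP[->//|/sc'->]; rewrite orbT.
  by apply: contraNneq nc' => -[->].
have /andP[sAB nAB] := pAB.
rewrite /coverb gB sAB nAB /= => /allPn[U _]; rewrite negb_imply negb_or.
case/andP => /and3P[gU sAU sUB] /andP[nUA nUB].
exists (U :: B :: c); split => //=; rewrite ?gU ?gB //.
- by rewrite /proper_subv sAU eq_sym nUA sUB nUB.
- by move=> V; rewrite !inE => ->; rewrite orbT.
- by apply/eqP => /(congr1 size) /= /eqP; rewrite -[_ == _]/((size c).+1 == size c) gtn_eqF.
Qed.

(** The first term [D] of the finer chain lies between [A] and the first cover [B], because [B]
    occurs in that chain; minimality forces [D = B], and the argument goes on from [B]. *)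
Lemma path_cover_maximal A c c' : path coverb A c -> last A c = fullv ->
  all (invariant g) c' -> path (@proper_subv F vT) A c' -> {subset c <= c'} -> c' = c.
Proof.
elim: c A c' => [|B c IH] A [|D c'] //=.
- by move=> _ -> _ /andP[/andP[sD nD] _] _; case/negP: nD; rewrite eqEsubv sD subvf.
- by move=> _ _ _ _ /(_ B (mem_head _ _)).
case/andP=> covAB pc lc /andP[gD gc'] /andP[/andP[sAD nAD] pc'] sub.
have DB : D = B.
  have [gB _ _ minB] := coverP _ _ covAB.
  have sDB : (D <= B)%VS.
    have := sub B (mem_head _ _); rewrite inE => /orP[/eqP->//|].
    by move/(allP (order_path_min proper_subv_trans pc')) => /andP[].
  by case: (minB D gD sAD sDB) => // DA; rewrite DA eqxx in nAD.
rewrite DB in pc' sub *; congr (_ :: _); apply: (IH B) => // U Uc.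
have := sub U; rewrite !inE Uc orbT => /(_ isT) /orP[/eqP UB|//].
have pc'' := sub_path coverb_proper pc.
by have := allP (order_path_min proper_subv_trans pc'') _ Uc;
  rewrite UB /proper_subv eqxx andbF.
Qed.

Lemma inv_chain_cons C : inv_chain g C ->
  exists c, [/\ C = 0%VS :: c, all (invariant g) c, path (@proper_subv F vT) 0%VS c
              & last 0%VS c = fullv].
Proof.
case: C => [|A c] /and4P[] //= /andP[_ gc] pc /eqP[A0]; rewrite A0 in pc *.
by move=> /eqP lc; exists c.
Qed.

Lemma inv_chainI c : all (invariant g) c -> path (@proper_subv F vT) 0%VS c ->
  last 0%VS c = fullv -> inv_chain g (0%VS :: c).
Proof. by move=> gc pc lc; rewrite /inv_chain /= invariant0 gc pc lc !eqxx. Qed.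

(** Turns maximality, a condition on all chains, into a decidable condition on successive terms. *)
Lemma jordan_holderP C : jordan_holder g C <->
  exists2 c, C = 0%VS :: c & path coverb 0%VS c && (last 0%VS c == fullv).
Proof.
split=> [[/inv_chain_cons[c [-> gc pc lc]] max]|[c -> /andP[pc /eqP lc]]].
  exists c; rewrite // lc eqxx andbT; apply: contraT => npc.
  have [c' [gc' pc' lc' sc' nc']] := path_refine gc pc npc.
  have chain' : inv_chain g (0%VS :: c') by apply: inv_chainI; rewrite ?lc'.
  have sub' : {subset 0%VS :: c <= 0%VS :: c'}.
    by move=> U; rewrite !inE => /orP[->//|/sc'->]; rewrite orbT.
  by case: (max _ chain' sub') => E; rewrite E eqxx in nc'.
have pc' := sub_path coverb_proper pc; split.
  apply: inv_chainI => //.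
  elim: c 0%VS pc {lc pc'} => //= B c IH A /andP[/coverP[gB _ _ _] /IH->].
  by rewrite gB.
move=> _ /inv_chain_cons[c' [-> gc' pc'' lc']] sub; congr (_ :: _).
apply: (path_cover_maximal pc lc gc' pc'') => U Uc.
have := sub U; rewrite !inE Uc orbT => /(_ isT) /orP[/eqP U0|//].
by have := allP (order_path_min proper_subv_trans pc') _ Uc;
  rewrite U0 /proper_subv eqxx andbF.
Qed.

Definition covers A := [seq B <- subspaces | coverb A B].

Lemma mem_covers A B : (B \in covers A) = coverb A B.
Proof. by rewrite mem_filter mem_subspaces andbT. Qed.

Lemma covers_uniq A : uniq (covers A).
Proof. by rewrite filter_uniq ?undup_uniq. Qed.

(* [n] is fuel; it is large enough as soon as it bounds the codimension of [A]. *)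
Fixpoint cover_chains n A : seq (seq {vspace vT}) :=
  if A == fullv then [:: [::]] else
  if n is m.+1 then [seq B :: c | B <- covers A, c <- cover_chains m B] else [::].

Lemma cover_dim_lt A B : coverb A B -> (\dim A < \dim B)%N.
Proof.
case/and4P=> _ sAB nAB _; rewrite ltn_neqAle dimvS // andbT.
by rewrite (dimv_leqif_eq sAB).
Qed.

(** Each cover raises the dimension, so fuel bounding the codimension is not exhausted before
    [fullv] is reached. *)
Lemma mem_cover_chains n A c : (\dim {:vT} <= \dim A + n)%N ->
  (c \in cover_chains n A) = path coverb A c && (last A c == fullv).
Proof.
elim: n A c => [|n IH] A c dimA /=; case: eqP => [->|/eqP nA].
- case: c => [|B c]; rewrite ?mem_seq1 ?eqxx //=.
  by case: coverP => // -[_ sB nB _]; case/eqP: nB; apply/eqP; rewrite eqEsubv sB subvf.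
- by case/negP: nA; rewrite eqEdim subvf -[X in (_ <= X)%N]addn0.
- case: c => [|B c]; rewrite ?mem_seq1 ?eqxx //=.
  by case: coverP => // -[_ sB nB _]; case/eqP: nB; apply/eqP; rewrite eqEsubv sB subvf.
case: c => [|B c] /=.
  by rewrite (negPf nA); apply/allpairsPdep => -[B [c []]].
apply/allpairsPdep/andP.
  case=> B' [c' [+ c'B [-> ->]]]; rewrite mem_covers => cov.
  move: c'B; rewrite IH; first by case/andP=> pc lc; rewrite cov pc.
  by have := cover_dim_lt cov; lia.
case=> /andP[cov pc] lc; exists B, c; split; rewrite ?mem_covers // IH ?pc //.
by have := cover_dim_lt cov; lia.
Qed.

Lemma cover_chains_uniq n A : uniq (cover_chains n A).
Proof.
elim: n A => [|n IH] A /=; case: eqP => // _.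
apply: allpairs_uniq_dep => [|B _|]; rewrite ?covers_uniq ?IH //.
by move=> [B c] [B' c'] _ _ /= [] -> ->.
Qed.

Lemma card_jordan_holder :
  has_card (jordan_holder g) (size (cover_chains (\dim {:vT}) 0%VS)).
Proof.
exists [seq 0%VS :: c | c <- cover_chains (\dim {:vT}) 0%VS]; split.
- by rewrite map_inj_uniq ?cover_chains_uniq // => c c' [].
- move=> C; rewrite jordan_holderP; split=> [/mapP[c +  ->]|[c -> pc]].
    by rewrite mem_cover_chains ?dimv0 //; exists c.
  by rewrite map_f // mem_cover_chains ?dimv0.
- exact: size_map.
Qed.

Lemma size_cover_chains n A : A != fullv ->
  size (cover_chains n.+1 A) = (\sum_(B <- covers A) size (cover_chains n B))%N.
Proof.
by move=> nA; rewrite /= (negPf nA) size_allpairs_dep sumnE big_map.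
Qed.

Lemma sum_memv_diff A B : (A <= B)%VS ->
  (\sum_(v : finvect_type vT) ((v \in B) && (v \notin A)) + #|F| ^ \dim A
   = #|F| ^ \dim B)%N.
Proof.
move=> sAB.
have cardE U : (#|F| ^ \dim U = \sum_(v : finvect_type vT) (v \in U))%N.
  rewrite -card_memv -sum1_card big_mkcond; apply: eq_bigr => v _.
  by rewrite inE; case: (v \in U).
rewrite !cardE -big_split /=.
apply: eq_bigr => v _; have := subvP sAB v; case: (v \in A) => [->|] //.
by case: (v \in B).
Qed.

(* Each vector of [X] outside [A] lies in exactly one cover of [A]. *)
Lemma count_covers (pi : {poly F}) A X : irreducible_poly pi ->
  invariant g A -> invariant g X ->
  (A <= X)%VS -> (X <= lfun_horner g pi @^-1: A)%VS ->
  (count (fun B => B <= X)%VS (covers A) * (#|F| ^ (size pi).-1).-1 * #|F| ^ \dim A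
   + #|F| ^ \dim A = #|F| ^ \dim X)%N.
Proof.
move=> irr gA gX sAX /subvP sXK; rewrite -(sum_memv_diff sAX); congr (_ + _)%N.
pose occ (v : finvect_type vT) :=
  (\sum_(B <- covers A | (B <= X)%VS) ((v \in B) && (v \notin A)))%N.
have -> : (\sum_(v : finvect_type vT) ((v \in X) && (v \notin A)) = \sum_v occ v)%N.
  apply: eq_bigr => v _; rewrite /occ; have [Av|nAv] := boolP (v \in A).
    by rewrite andbF big1 // => B _; rewrite andbF.
  have [Xv|nXv] := boolP (v \in X); last first.
    rewrite big1 // => B sBX; rewrite andbT; apply/eqP; rewrite eqb0.
    by apply: contra nXv; apply/subvP.
  have piv : lfun_horner g pi v \in A by rewrite memv_preim sXK.
  (* The only cover containing [v] is the one that [v] generates over [A]. *)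
  pose B0 := (A + cyc g (size pi).-1 v)%VS.
  have cov0 : inv_cover g A B0 := cover_add_cyc irr gA piv nAv.
  have B0v : v \in B0 := mem_gen_add_cyc gA (irredp_neq0 irr) piv.
  transitivity (count_mem B0 (covers A)).
    by rewrite count_uniq_mem ?covers_uniq // mem_covers; case: coverP.
  rewrite -sum1_count big_mkcond [RHS]big_mkcond; apply: eq_big_seq => B.
  rewrite mem_covers => /coverP covB /=; rewrite andbT.
  have [->|neq] := eqVneq B B0; first by rewrite B0v (add_cyc_sub pi gX sAX Xv).
  case: ifP => // _; case: (boolP (v \in B)) => // Bv.
  by rewrite (coverE irr gA covB Bv piv nAv) eqxx in neq.
(* Summed cover by cover instead, each [B] inside [X] contributes [|B| - |A|] vectors, where [|B|]
   is [Q] times [|A|]. *)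
rewrite exchange_big /=.
rewrite -mulnA -sum1_count big_distrl /=.
rewrite big_mkcond [RHS]big_mkcond; apply: eq_big_seq => B.
rewrite mem_covers => /coverP covB; case: ifP => // sBX; have [_ sAB _ _] := covB.
have sBK : (B <= lfun_horner g pi @^-1: A)%VS by apply/subvP => v /(subvP sBX)/sXK.
apply/eqP; rewrite mul1n -(eqn_add2r (#|F| ^ \dim A)) (sum_memv_diff sAB).
rewrite (dim_cover irr gA covB sBK) expnD -mulSnr prednK 1?mulnC //.
by rewrite expn_gt0 (ltnW (finNzRing_gt1 F)).
Qed.

End Chains.

(** * The recursion satisfied by the claimed formula *)

Section WeightFormula.

Variables (q s : nat) (delta : 'I_s -> nat).
Implicit Types T : 'I_s -> seq nat.

Definition lower_family T (l : 'I_s) i : 'I_s -> seq nat :=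
  fun l' => if l' == l then lower_cell (T l) i else T l'.

(** Rational-valued, so that the recursion can rescale the multinomial coefficient by fractions. *)
Definition weight_formula T : rat :=
  ((\sum_(l < s) sumn (T l))`!)%N%:R / (\prod_(l < s) (sumn (T l))`!)%N%:R
  * (\prod_(l < s) total_weight q (delta l) (sumn (T l)) (T l))%N%:R.

Lemma weight_formula_nil T : (forall l, T l = [::]) -> weight_formula T = 1.
Proof.
move=> T0; rewrite /weight_formula !big1 ?divr1 ?mulr1 // => l _; by rewrite T0.
Qed.

(** Lowering a cell of [T l] multiplies the multinomial coefficient by [tau_l / tau], with [tau] the
    sum of all entries; the weights add up by the recursion defining [total_weight]. *)
Lemma weight_formula_row T l : (forall l', table (T l')) ->
  \sum_(i < size (T l) | admissible (T l) i)
     (step_weight q (delta l) (T l) i)%:R * weight_formula (lower_family T l i)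
  = weight_formula T * (sumn (T l))%:R / (\sum_(l < s) sumn (T l))%N%:R.
Proof.
move=> tabT; case tauE : (sumn (T l)) => [|n].
  have -> : T l = [::].
    by case: (T l) (tabT l) tauE => // x t /andP[_]; rewrite inE negb_or; case: x.
  by rewrite big_ord0 mulr0 mul0r.
(* [m], [d] and [w] gather the contributions of the other tables, which do not change. *)
pose m := (\sum_(l' < s | l' != l) sumn (T l'))%N.
pose d := (\prod_(l' < s | l' != l) (sumn (T l'))`!)%N.
pose w := (\prod_(l' < s | l' != l) total_weight q (delta l') (sumn (T l')) (T l'))%N.
have d0 : d%:R != 0 :> rat.
  by rewrite pnatr_eq0 -lt0n prodn_cond_gt0 // => l' _; rewrite fact_gt0.
have wfE T' : weight_formula T' =
    ((sumn (T' l) + \sum_(l' < s | l' != l) sumn (T' l'))`!)%N%:R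
    / ((sumn (T' l))`! * \prod_(l' < s | l' != l) (sumn (T' l'))`!)%N%:R
    * (total_weight q (delta l) (sumn (T' l)) (T' l)
       * \prod_(l' < s | l' != l) total_weight q (delta l') (sumn (T' l')) (T' l'))%N%:R.
  rewrite /weight_formula (bigD1 l) //=; congr (_ / _%:R * _%:R).
    by rewrite (bigD1 l).
  by rewrite (bigD1 l).
have fE i : admissible (T l) i -> weight_formula (lower_family T l i) =
    ((n + m)`!)%:R / (n`! * d)%N%:R
    * (total_weight q (delta l) n (lower_cell (T l) i) * w)%N%:R.
  move=> adm; have [_ _ sumE] := lower_cell_table (tabT l) adm.
  have {}sumE : sumn (lower_cell (T l) i) = n by move: sumE; rewrite tauE => -[].
  have lowE : lower_family T l i l = lower_cell (T l) i by rewrite /lower_family eqxx.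
  have lowN l' : l' != l -> lower_family T l i l' = T l'.
    by move/negPf=> E; rewrite /lower_family E.
  rewrite wfE lowE sumE; congr (_`!%:R / (_ * _)%N%:R * (_ * _)%N%:R).
  - by congr (_ + _)%N; apply: eq_bigr => l' /lowN->.
  - by apply: eq_bigr => l' /lowN->.
  - by apply: eq_bigr => l' /lowN->.
rewrite (eq_bigr (fun i : 'I_(size (T l)) =>
   (step_weight q (delta l) (T l) i * total_weight q (delta l) n (lower_cell (T l) i))%N%:R
   * (((n + m)`!)%:R / (n`! * d)%N%:R * w%:R))); last first.
  by move=> i adm; rewrite fE // !natrM; ring.
rewrite -big_distrl -natr_sum /=.
rewrite -[(\sum_(i < _ | _) _)%N]/(total_weight q (delta l) n.+1 (T l)).
have tauS : (\sum_(l' < s) sumn (T l') = (n + m).+1)%N by rewrite (bigD1 l) //= tauE addSn.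
rewrite tauS wfE -/m -/d -/w tauE addSn !factS !natrM.
have nz k : k.+1%:R != 0 :> rat by rewrite pnatr_eq0.
have fz k : k`!%:R != 0 :> rat by rewrite pnatr_eq0 -lt0n fact_gt0.
move: (nz n) (nz (n + m)%N) (fz n) d0; move: n.+1%:R (n + m).+1%:R n`!%:R d%:R => a b c e.
move: (_%:R) ((n + m)`!%:R) w%:R => x y z a0 b0 c0 e0.
by field; rewrite a0 b0 c0 e0.
Qed.

(** The fractions [tau_l / tau] add up to 1. *)
Lemma weight_formula_rec T : (forall l, table (T l)) -> (0 < \sum_l sumn (T l))%N ->
  \sum_l \sum_(i < size (T l) | admissible (T l) i)
     (step_weight q (delta l) (T l) i)%:R * weight_formula (lower_family T l i)
  = weight_formula T.
Proof.
move=> tabT tau0; under eq_bigr do rewrite weight_formula_row //.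
rewrite -big_distrl -big_distrr /= -natr_sum -mulrA divff ?mulr1 //.
by rewrite pnatr_eq0 -lt0n.
Qed.

End WeightFormula.

(** * Tables of quotients and classification of covers *)

Section TypeInduction.

Variables (F : finFieldType) (vT : vectType F) (g : 'End(vT)).
Variables (s : nat) (pi : 'I_s -> {poly F}) (e : 'I_s -> nat).
Implicit Types (A B U X : {vspace vT}) (T : 'I_s -> seq nat) (l : 'I_s).

Local Notation ev p := (lfun_horner g p).
Local Notation q := #|F|.

Hypothesis irr_pi : forall l, irreducible_poly (pi l).
Hypothesis co_pi : forall l l', l != l' -> coprimep (pi l) (pi l').
Hypothesis ann_pi : forall v, ev (\prod_l pi l ^+ e l) v = 0.

(* For each [k], the [pi l ^+ k]-torsion (or cotorsion) of [vT / A] has the dimension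
   prescribed by the tables; this determines the type of the quotient module. *)
Definition has_tables A T : Prop :=
  invariant g A /\ forall l, table (T l) /\ forall k,
    (\dim (limg (ev (pi l ^+ k)) + A) + (size (pi l)).-1 * truncated_sum (T l) k
     = \dim {:vT})%N.

(** The [X_k] belonging to [pi l]; it decreases with [k]. *)
Definition layer A l k : {vspace vT} :=
  ((ev (pi l) @^-1: A) :&: (A + limg (ev (pi l ^+ k))))%VS.

(** Kernel and cokernel of [pi l ^+ k] on [vT / A] have the same dimension. *)
Lemma dim_preim A T l k : has_tables A T ->
  \dim (ev (pi l ^+ k) @^-1: A) = (\dim A + (size (pi l)).-1 * truncated_sum (T l) k)%N.
Proof.
case=> _ /(_ l)[_ /(_ k)]; have := dim_cap_preim (ev (pi l ^+ k)) A fullv.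
rewrite capfv addvC; lia.
Qed.

(** The layer measures the growth of the torsion from [k] to [k.+1], to which exactly the cells
    greater than [k] contribute. *)
Lemma dim_layer A T l k : has_tables A T ->
  \dim (layer A l k) = (\dim A + (size (pi l)).-1 * count (ltn k) (T l))%N.
Proof.
move=> tabA; have [gA _] := tabA; have := dim_socle_layer (pi l) gA k.
rewrite (capv_idPr (preim_exprS (pi l) gA k)) !(dim_preim _ _ tabA) truncated_sumS.
rewrite /layer mulnDr.
by move=> E; apply: (addnI (etrans E _)); rewrite addnAC !addnA addnAC.
Qed.

Lemma layer_inv A l k : invariant g A -> invariant g (layer A l k).
Proof.
move=> gA; apply: invariant_cap; first exact: invariant_preim.
by apply: invariant_add => //; apply/invariant_limg/invariantf.
Qed.

Lemma sub_layer A l k : invariant g A -> (A <= layer A l k)%VS.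
Proof. by move=> gA; rewrite subv_cap addvSl sub_preim. Qed.

Lemma layer_sub A l k : (layer A l k <= ev (pi l) @^-1: A)%VS.
Proof. exact: capvSl. Qed.

Lemma layerS A l k k' : (k <= k')%N -> (layer A l k' <= layer A l k)%VS.
Proof.
move=> le_kk'; apply/capvS/addvS => //; apply/subvP => _ /memv_imgP[v _ ->].
by rewrite -(subnKC le_kk') exprD lfun_hornerM memv_img ?memvf.
Qed.

(** Acting injectively on [B] modulo [A] is stable under products, and the product of the
    [pi l ^+ e l], which kills everything, can do so only if [B] lies in [A]. *)
Lemma torsion_free_sub A B : invariant g B ->
  (forall l v, v \in B -> ev (pi l) v \in A -> v \in A) -> (B <= A)%VS.
Proof.
move=> gB tf; apply/subvP => v Bv.
pose P p := forall v, v \in B -> ev p v \in A -> v \in A.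
suff PP : P (\prod_l pi l ^+ e l) by apply: (PP) => //; rewrite ann_pi mem0v.
have PM p1 p2 : P p1 -> P p2 -> P (p1 * p2).
  move=> P1 P2 w Bw; rewrite lfun_hornerM => /P1 P1w; apply: P2 => //; apply: P1w.
  exact: invariant_horner.
have P1 : P 1 by move=> w _; rewrite lfun_horner1.
apply: big_ind => // l _; elim: (e l) => [|k IH]; first by rewrite expr0.
by rewrite exprS; apply: PM => //; apply: tf.
Qed.

(** Otherwise, by minimality of the cover, every [pi l] acts injectively on [B] modulo [A], which
    forces [B] into [A]. *)
Lemma inv_cover_prime A B : invariant g A -> inv_cover g A B ->
  exists l, (B <= ev (pi l) @^-1: A)%VS.
Proof.
move=> gA covB; have [gB sAB nAB _] := covB.
have [/existsP//|] := boolP [exists l, B <= ev (pi l) @^-1: A]%VS.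
rewrite negb_exists => /forallP nB; case/negP: nAB.
rewrite eqEsubv sAB; apply: torsion_free_sub => // l v Bv piv.
rewrite -(cover_cap gA covB (invariant_preim (pi l) gA) (sub_preim (pi l) gA) (nB l)).
by rewrite memv_cap Bv -memv_preim.
Qed.

(** The case [k = 1] decides: there [truncated_sum] counts the cells, and without cells there is no
    [pi l]-torsion modulo [A]. *)
Lemma has_tables_nil A T : has_tables A T -> (A == fullv) = [forall l, T l == [::]].
Proof.
move=> tabA; have [gA tabT] := tabA; apply/eqP/forallP => [A1 l|T0].
  have [tab /(_ 1)] := tabT l; rewrite A1 addvf.
  have d0 := delta_gt0 (irr_pi l).
  move=> /eqP; rewrite -[X in _ == X]addn0 eqn_add2l muln_eq0 -[_ == 0]/(_ == 0%N).
  rewrite eqn0Ngt d0 /=; case: (T l) tab => // x t /andP[_].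
  by rewrite inE negb_or => /andP[x0 _]; rewrite /truncated_sum /=; lia.
apply/eqP; rewrite eqEsubv subvf; apply: torsion_free_sub; first exact: invariantf.
move=> l v _; rewrite memv_preim.
suff -> : (ev (pi l) @^-1: A)%VS = A by [].
apply/eqP; rewrite eq_sym eqEdim sub_preim //=.
have := dim_preim l 1 tabA; rewrite expr1 => ->.
by rewrite (eqP (T0 l)) /truncated_sum muln0 addn0.
Qed.

Section Class.

Variables (A : {vspace vT}) (T : 'I_s -> seq nat).
Hypothesis tabA : has_tables A T.

Let gA : invariant g A. Proof. by case: tabA. Qed.
Let tabT l : table (T l). Proof. by case: tabA => _ /(_ l)[]. Qed.

(* The covers [B] of [A] for which the type of [vT / B] is that of [vT / A] with
   the cell [i] of the table [T l] lowered. *)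
Definition in_class l i B : bool :=
  (B <= layer A l (nth 0%N (T l) i).-1)%VS && ~~ (B <= layer A l (nth 0%N (T l) i))%VS.

Lemma has_tables_lower l i B : inv_cover g A B -> admissible (T l) i ->
  in_class l i B -> has_tables B (lower_family T l i).
Proof.
move=> covB adm /andP[sB nB]; have [gB sAB _ _] := covB; split=> // l'.
have sBK := subv_trans sB (layer_sub _ _ _).
have [_ /(_ l')[tabl' dimA]] := tabA; rewrite /lower_family.
(* For another factor, [pi l' ^+ k] is invertible on [B / A], so [B] already lies in its image plus
   [A] and the dimension is unchanged. *)
have [ll'|nll'] := eqVneq l' l; last first.
  split=> // k; rewrite (dim_limg_add_cover_sub covB) //.
  apply: (cover_sub_coprime gA sBK); rewrite coprimep_expr // co_pi //.
  by rewrite eq_sym.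
rewrite -ll'; rewrite -ll' in adm sB nB sBK *.
have [tab' _ _] := lower_cell_table tabl' adm.
split=> // k; have := truncated_sum_lower k tabl' adm; have := dimA k.
have ti := table_nth_gt0 tabl' (proj1 (andP adm)).
(* From [k = t_i] on, [B] is not contained in the image plus [A], and adding it raises the dimension
   by the degree of [pi l'], matching the loss in [truncated_sum]. For smaller [k] it is contained
   and neither term changes. *)
have [le_tk|lt_kt] := leqP (nth 0%N (T l') i) k.
  rewrite (dim_limg_add_cover (irr_pi l') gA covB sBK).
    by move=> dA tE; rewrite -dA -tE addn1 mulnS addnA.
  apply: contra nB => sBk; apply: subv_trans (layerS _ _ le_tk).
  by rewrite subv_cap sBK.
rewrite addn0 (dim_limg_add_cover_sub covB) => [dA tE|]; first by rewrite tE.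
apply: subv_trans sB _; apply: subv_trans (layerS _ _ (_ : k <= _)%N) (capvSr _ _).
by lia.
Qed.

(** Two coprime factors cannot both kill [B / A]. For a given factor the layers decrease, so [B]
    drops out of them at one value only, and this value determines the admissible cell. *)
Lemma in_class_inj B l i l' i' : inv_cover g A B ->
  admissible (T l) i -> admissible (T l') i' -> in_class l i B -> in_class l' i' B ->
  l = l' /\ i = i'.
Proof.
move=> covB ai ai' /andP[s1 n1] /andP[s2 n2].
have ll' : l = l'.
  apply/eqP; apply: contraT => nll'.
  case: (cover_coprime_disj gA (co_pi nll') covB).
    exact: subv_trans s1 (layer_sub _ _ _).
  exact: subv_trans s2 (layer_sub _ _ _).
rewrite -ll' in ai' s2 n2 *; split=> //; apply: (admissible_inj (tabT l)) => //.
have lt k k' : (B <= layer A l k.-1)%VS -> ~~ (B <= layer A l k')%VS -> (k <= k')%N.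
  move=> sk nk'; rewrite leqNgt; apply: contra nk' => lt.
  by apply: subv_trans sk (layerS _ _ _); lia.
by apply/eqP; rewrite eqn_leq !lt.
Qed.

Lemma in_class_exists B : inv_cover g A B ->
  exists l i, admissible (T l) i /\ in_class l i B.
Proof.
move=> covB; have [l sBK] := inv_cover_prime gA covB; exists l.
have [w Bw nAw] := cover_witness covB.
(* No cell exceeds [sumn (T l)], so that layer is reduced to [A]. *)
have ex : exists k, ~~ (B <= layer A l k)%VS.
  exists (sumn (T l)); apply: contra nAw => /subvP/(_ w Bw).
  suff -> : layer A l (sumn (T l)) = A by [].
  apply/eqP; rewrite eq_sym eqEdim sub_layer //= (dim_layer _ _ tabA).
  by rewrite count_gt_sumn muln0 addn0.
(* The least such index is positive, as layer 0 is the whole preimage of [A] under [pi l]. *)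
case: (ex_minnP ex) => -[|k] nB min.
  case/negP: nB; rewrite subv_cap sBK expr0.
  apply: (subv_trans (subvf B)); apply: subv_trans (addvSr _ _).
  by apply/subvP => v _; rewrite -(lfun_horner1 g v) memv_img ?memvf.
have sB : (B <= layer A l k)%VS.
  by apply: contraT => /min; rewrite ltnn.
(* If no cell were equal to [k.+1], layers [k] and [k.+1] would have the same dimension. *)
have kT : k.+1 \in T l.
  apply: contraT => nkT; case/negP: nB.
  suff /eqP-> : layer A l k.+1 == layer A l k by [].
  rewrite eqEdim layerS //= !(dim_layer _ _ tabA).
  suff -> : count (ltn k) (T l) = count (ltn k.+1) (T l) by [].
  apply: eq_in_count => x xT /=; have : x != k.+1 by apply: contraNneq nkT => <-.
  by lia.
have [i adm iE] := admissible_exists (tabT l) kT.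
by exists i; split=> //; rewrite /in_class iE sB.
Qed.

(** Subtract [count_covers] for two successive layers; the positive factor [Q - 1] cancels against
    the geometric sum. *)
Lemma count_class l i : admissible (T l) i ->
  count (in_class l i) (covers g A) = step_weight q (size (pi l)).-1 (T l) i.
Proof.
move=> adm; have q1 : (1 < q)%N := finNzRing_gt1 F.
have cnt k : (count (fun B => B <= layer A l k)%VS (covers g A) * (q ^ (size (pi l)).-1).-1
              + 1 = (q ^ (size (pi l)).-1) ^ count (ltn k) (T l))%N.
  have := count_covers (irr_pi l) gA (layer_inv l k gA) (sub_layer l k gA)
    (layer_sub A l k).
  rewrite (dim_layer _ _ tabA) expnD expnM -mulSnr (mulnC _.+1) -addn1 => /eqP.
  by rewrite eqn_pmul2l ?expn_gt0 ?(ltnW q1) // => /eqP.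
have := step_weight_mul (size (pi l)).-1 (ltnW q1) (tabT l) adm.
rewrite -!cnt addnA => /addIn E.
have split : (count (in_class l i) (covers g A)
    + count (fun B => B <= layer A l (nth 0%N (T l) i))%VS (covers g A)
    = count (fun B => B <= layer A l (nth 0%N (T l) i).-1)%VS (covers g A))%N.
  rewrite -count_predUI addnC -[RHS]add0n; congr (_ + _)%N.
    apply/eqP; rewrite -leqn0 leqNgt -has_count; apply/hasPn => B _ /=.
    by rewrite /in_class; case: (B <= layer A l (nth _ _ _))%VS; rewrite ?andbF.
  apply: eq_count => B /=; rewrite /in_class orbC.
  have [sB|] := boolP (B <= layer A l (nth _ _ _))%VS; rewrite ?andbT //=.
  by rewrite (subv_trans sB) // layerS ?leq_pred.
apply/eqP; have d0 := delta_gt0 (irr_pi l).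
have Q0 : (0 < (q ^ (size (pi l)).-1).-1)%N.
  by rewrite -ltnS prednK ?expn_gt0 ?(ltnW q1) // -(expn0 q) ltn_exp2l.
pose c := count (fun B => B <= layer A l (nth 0%N (T l) i))%VS (covers g A).
by rewrite -(eqn_pmul2r Q0) -(eqn_add2r (c * (q ^ (size (pi l)).-1).-1)) -mulnDl split E.
Qed.

Lemma sum_covers (f : {vspace vT} -> nat) :
  (\sum_(B <- covers g A) f B =
   \sum_l \sum_(i < size (T l) | admissible (T l) i)
     \sum_(B <- covers g A | in_class l i B) f B)%N.
Proof.
under [RHS]eq_bigr do rewrite (exchange_big_dep xpredT) //=.
rewrite exchange_big /=; apply: eq_big_seq => B; rewrite mem_covers => /coverP covB.
have [l [i [adm cl]]] := in_class_exists covB.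
rewrite (bigD1 l) //= [X in (_ + X)%N]big1 ?addn0 => [|l' nl']; last first.
  rewrite big1 // => i' /andP[adm' cl'].
  by have [E _] := in_class_inj covB adm' adm cl' cl; rewrite E eqxx in nl'.
have lti := proj1 (andP adm).
rewrite (bigD1 (Ordinal lti)) /= ?adm ?cl // big1 ?addn0 //.
move=> i' /andP[/andP[adm' cl'] ni'].
have [_ E] := in_class_inj covB adm' adm cl' cl.
by case/eqP: ni'; apply: val_inj.
Qed.

End Class.

(** Both sides obey the same recursion: a nonempty chain above [A] starts with a cover in exactly
    one class, and above that cover the tables are the lowered ones. *)
Lemma size_cover_chainsE n A T : has_tables A T -> (\dim {:vT} <= \dim A + n)%N ->
  (size (cover_chains g n A))%:R = weight_formula q (fun l => (size (pi l)).-1) T.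
Proof.
elim: n A T => [|n IH] A T tabA dimA.
  have A1 : A == fullv by rewrite eqEdim subvf -[X in (_ <= X)%N]addn0.
  rewrite /= A1 weight_formula_nil // => l; apply/eqP.
  by move: A1; rewrite (has_tables_nil tabA) => /forallP.
have [A1|nA1] := boolP (A == fullv).
  rewrite /= A1 weight_formula_nil // => l; apply/eqP.
  by move: A1; rewrite (has_tables_nil tabA) => /forallP.
have tabT l : table (T l) by case: tabA => _ /(_ l)[].
rewrite size_cover_chains // (sum_covers tabA) -weight_formula_rec //; last first.
  rewrite lt0n; apply: contra nA1 => tau0; rewrite (has_tables_nil tabA).
  apply/forallP => l; move: tau0; rewrite sum_nat_eq0 => /forallP/(_ l) /=.
  by case: (T l) (tabT l) => // x t /andP[_]; rewrite inE negb_or /=; case: x.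
rewrite natr_sum; apply: eq_bigr => l _; rewrite natr_sum; apply: eq_bigr => i adm.
rewrite natr_sum -(count_class tabA adm) -sum1_count natr_sum big_distrl /=.
rewrite big_seq_cond [RHS]big_seq_cond; apply: eq_bigr => B /andP[].
rewrite mem_covers => covB cl; rewrite mul1r; apply: IH.
  exact: (has_tables_lower tabA) (coverP _ _ _ covB) adm cl.
by have := cover_dim_lt covB; lia.
Qed.

End TypeInduction.

(** * Cyclic modules and Jordan blocks *)

Section CyclicModules.

Variables (F : fieldType) (vT : vectType F) (g : 'End(vT)).
Implicit Types (p r pi : {poly F}) (B U W : {vspace vT}) (b : vT).

Local Notation ev p := (lfun_horner g p).

(** An internal form of an isomorphism from [F[Y]/(p)] to [U], with [b] the image of the class of
    1. *)
Definition cyclic_gen U p b : Prop :=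
  [/\ invariant g U, b \in U, forall w, w \in U -> exists r, w = ev r b
    & forall r, (ev r b == 0) = (p %| r)].

Lemma iso_cyclic_gen U p : p \is monic -> (1 < size p)%N -> iso_cyclic g U p ->
  exists b, cyclic_gen U p b.
Proof.
move=> mon_p sz_p [h [kerh imh comm]].
have hX x : h ('qX * x) = g (h x) by rewrite -mul_qXE comm ?memvf.
(* For monic nonconstant [p], the type [{poly %/ p}] is the genuine quotient by [p]. *)
have mkE : mk_monic p = p by rewrite /mk_monic sz_p mon_p.
pose b := h 1.
have hE r : ev r b = h (in_qpoly p r).
  elim/poly_ind: r => [|r c IH]; first by rewrite lfun_horner0 in_qpoly0 linear0.
  rewrite lfun_hornerD lfun_hornerXM lfun_horner_comm lfun_hornerC IH -hX.
  rewrite in_qpolyD in_qpolyM mulrC linearD /=; congr (_ + _).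
  by rewrite -[c%:P]mulr1 mul_polyC in_qpolyZ in_qpoly1 linearZ.
have reprE (x : {poly %/ p}) : x = in_qpoly p (x : {poly F}).
  by apply/val_inj/esym/in_qpoly_small/size_mk_monic.
have hU x : h x \in U by rewrite -imh memv_img ?memvf.
exists b; split=> //.
- apply/invariantP => w; rewrite -{1}imh => /memv_imgP[x _ ->].
  by rewrite -hX.
- exact: hU.
- by move=> w; rewrite -imh => /memv_imgP[x _ ->]; exists x; rewrite hE -reprE.
move=> r; rewrite hE -memv_ker; rewrite capfv in kerh; rewrite kerh memv0.
rewrite -val_eqE /= mkE /dvdp -[X in _ = (X == 0)]/(modp r p).
by rewrite Pdiv.IdomainMonic.modpE.
Qed.

Lemma dim_cyclic_gen U p b : p != 0 -> cyclic_gen U p b -> \dim U = (size p).-1.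
Proof.
move=> p0 [gU Ub gen ann].
have pb : ev p b \in 0%VS by rewrite memv0 ann.
have -> : U = (0 + cyc g (size p).-1 b)%VS.
  apply/eqP; rewrite eqEsubv (add_cyc_sub p gU (sub0v U) Ub) andbT.
  by apply/subvP => w /gen[r ->]; apply: (mem_add_cyc (invariant0 g) p0 pb).
rewrite (dim_add_cyc p0) ?dimv0 // => r.
by rewrite memv0 ann.
Qed.

(** Multiplication by [pi^k] turns [F[Y]/(pi^t)] into a copy of [F[Y]/(pi^(t-k))]; for [k > t],
    truncated subtraction gives the zero module, as it should. *)
Lemma cyclic_gen_limg U pi t k b : pi != 0 -> cyclic_gen U (pi ^+ t) b ->
  cyclic_gen (ev (pi ^+ k) @: U) (pi ^+ (t - k)) (ev (pi ^+ k) b).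
Proof.
move=> pi0 [gU Ub gen ann]; split; first exact: invariant_limg.
- exact: memv_img.
- by move=> _ /memv_imgP[w /gen[r ->] ->]; exists r; rewrite lfun_hornerMC.
move=> r; rewrite -lfun_hornerM ann; have [le_kt|lt_tk] := leqP k t.
  by rewrite -{1}(subnK le_kt) exprD dvdp_mul2r // expf_neq0.
rewrite (_ : t - k = 0)%N; last by lia.
by rewrite expr0 dvd1p -(subnK (ltnW lt_tk)) exprD mulrA dvdp_mulIr.
Qed.

Lemma dim_limg_cyclic U pi t k b : pi != 0 -> cyclic_gen U (pi ^+ t) b ->
  (\dim (ev (pi ^+ k) @: U) + (size pi).-1 * minn t k)%N = \dim U.
Proof.
move=> pi0 gen; rewrite (dim_cyclic_gen _ gen) ?expf_neq0 //.
rewrite (dim_cyclic_gen _ (cyclic_gen_limg k pi0 gen)) ?expf_neq0 //.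
by rewrite !size_exp -mulnDr; congr (_ * _)%N; lia.
Qed.

(** Each image stays inside its own summand, so independence is inherited. *)
Lemma dim_limg_directv (I : finType) (f : 'End(vT)) (Us : I -> {vspace vT}) :
  directv (\sum_i Us i) -> (forall i, f @: Us i <= Us i)%VS ->
  \dim (f @: (\sum_i Us i)) = (\sum_i \dim (f @: Us i))%N.
Proof.
move=> /directv_sum_independent dir sub; rewrite limg_sum.
apply/directvP/directv_sum_independent => us Uus us0 i _.
by apply: dir => // j _; apply: (subvP (sub j)); apply: Uus.
Qed.

Lemma iso_cyclic_mod_iso W W' p : iso_cyclic g W p -> iso_cyclic g W' p ->
  mod_iso g W g W'.
Proof.
move=> [h [kerh imh comm]] [h' [kerh' imh' comm']].
have kerh0 : lker h == 0%VS by rewrite -kerh capfv.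
have kerh'0 : lker h' == 0%VS by rewrite -kerh' capfv.
have hK := lker0_lfunK kerh0.
exists (h' \o h^-1)%VF; split.
- apply/eqP; rewrite -subv0; apply/subvP => w; rewrite memv_cap memv_ker memv0.
  rewrite -imh => /andP[/memv_imgP[x _ ->]]; rewrite comp_lfunE hK -memv_ker.
  by rewrite (eqP kerh'0) memv0 => /eqP->; rewrite linear0.
- by rewrite -imh -limg_comp -comp_lfunA lker0_compVf // comp_lfun1r.
move=> w; rewrite -imh => /memv_imgP[x _ ->].
by rewrite -comm ?memvf // !comp_lfunE !hK comm' ?memvf.
Qed.

Lemma truncated_sumE t k : truncated_sum t k = (\sum_(j < size t) minn (nth 0 t j) k)%N.
Proof. by rewrite /truncated_sum sumnE big_map (big_nth 0%N) big_mkord. Qed.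

Lemma dim_limg_jordan U pi t k : pi \is monic -> irreducible_poly pi ->
  jordan_table g U pi t ->
  (\dim (ev (pi ^+ k) @: U) + (size pi).-1 * truncated_sum t k)%N = \dim U.
Proof.
move=> mon_pi irr_pi [tab [B [dir <- cycB]]].
have pi0 := irredp_neq0 irr_pi; have d0 := delta_gt0 irr_pi.
have genB j : exists b, cyclic_gen (B j) (pi ^+ nth 0%N t j) b.
  apply: iso_cyclic_gen => //; first exact: monic_exp.
  (* Entries of a table are positive, so these powers of [pi] are nonconstant. *)
  have := size_exp pi (nth 0%N t j); have := table_nth_gt0 tab (ltn_ord j).
  by case: (size (pi ^+ _)) => [|[|//]] /= t0 /esym /eqP; rewrite muln_eq0 !gtn_eqF.
rewrite dim_limg_directv //; last first.
  move=> j; have [b [gB _ _ _]] := genB j; apply/subvP => _ /memv_imgP[v Bv ->].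
  exact: invariant_horner.
rewrite (directvP dir) /= truncated_sumE big_distrr -big_split /=.
by apply: eq_bigr => j _; have [b /(dim_limg_cyclic k pi0)] := genB j.
Qed.

End CyclicModules.

(** * From the type of [g] to the final count *)

Lemma has_type_tables (F : finFieldType) (vT : vectType F) (g : 'End(vT)) s
    (W : 'I_s -> {vspace vT}) (T : 'I_s -> seq nat) : has_type g W T ->
  exists pi : 'I_s -> {poly F},
    [/\ forall l, irreducible_poly (pi l),
        forall l l', l != l' -> coprimep (pi l) (pi l'),
        exists e : 'I_s -> nat,
          forall v, lfun_horner g (\prod_l pi l ^+ e l) v = 0,
        forall l, \dim (W l) = (size (pi l)).-1
      & has_tables g pi 0 T].
Proof.
case=> _ isoW _ [pi [VP [piP [dirVP sumVP primVP] tabVP]]]; exists pi.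
have irr l : irreducible_poly (pi l) by case: (piP l).
have mon l : pi l \is monic by case: (piP l).
(* If one divided the other, these monic irreducible polynomials would be equal, hence [W l] and
   [W l'] isomorphic. *)
have co l l' : l != l' -> coprimep (pi l) (pi l').
  move=> nll'; rewrite irreducible_poly_coprime //; apply: contra nll' => dvd.
  have [_ /(_ _ _ dvd)] := irr l'; rewrite eqp_monic // => E; apply/eqP/isoW.
  have [_ _ cl] := piP l; have [_ _ cl'] := piP l'.
  apply: iso_cyclic_mod_iso cl _; suff -> : pi l = pi l' by [].
  by apply/eqP/E; case: (irr l) => sz _; rewrite gtn_eqF.
(* The exponents come from the minimal polynomials on the primary components. *)
have [e eP] : exists e : 'I_s -> nat, forall l v, v \in VP l ->
    lfun_horner g (pi l ^+ e l) v = 0.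
  apply: (@fin_all_exists _ (fun _ => nat) (fun l k => forall v, v \in VP l ->
    lfun_horner g (pi l ^+ k) v = 0)) => l.
  have [_ [k [_ /(_ (pi l ^+ k)) [+ _]]]] := primVP l.
  by move=> /(_ (dvdpp _)) kP; exists k.
split=> //.
- exists e => v; have : v \in fullv := memvf v.
  rewrite -sumVP => /memv_sumP[vs VPvs ->]; rewrite linear_sum big1 // => l _ /=.
  by rewrite (bigD1 l) //= mulrC lfun_hornerM eP ?VPvs // linear0.
- move=> l; have [_ [sz _] cl] := piP l.
  have [b gen] := iso_cyclic_gen (mon l) sz cl.
  by rewrite (dim_cyclic_gen _ gen) // irredp_neq0.
split=> [|l]; first exact: invariant0.
have [tab _] := tabVP l; split=> // k.
rewrite addv0 -sumVP dim_limg_directv //; last first.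
  move=> l'; have [gVP _] := primVP l'; apply/subvP => _ /memv_imgP[v Bv ->].
  exact: invariant_horner.
rewrite (directvP dirVP) /= (bigD1 l) //= [RHS](bigD1 l) //=.
rewrite -(dim_limg_jordan k (mon l) (irr l) (tabVP l)) addnAC; congr (_ + _)%N.
(* On the other components [pi l ^+ k] is injective, being coprime to the power of [pi l'] that
   kills them. *)
apply: eq_bigr => l' nll'; apply: limg_dim_eq; apply/eqP; rewrite -subv0.
apply/subvP => v; rewrite memv_cap memv_ker -memv0 => /andP[VPv kv].
have ev : lfun_horner g (pi l' ^+ e l') v \in 0%VS by rewrite (eP _ _ VPv) mem0v.
apply: (coprimep_horner_mem _ (invariant0 g) kv ev).
by rewrite coprimep_expl // coprimep_expr // co // eq_sym.
Qed.

Theorem proposition2p6p6 (F : finFieldType) (vT : vectType F) (g : 'End(vT))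
    (s : nat) (W : 'I_s -> {vspace vT}) (T : 'I_s -> seq nat)
    (hT : has_type g W T) :
  exists2 N : nat, has_card (jordan_holder g) N
  & N%:R = ((\sum_(l < s) sumn (T l))`!)%N%:R / (\prod_(l < s) (sumn (T l))`!)%N%:R
           * (\sum_(G : {dffun forall l : 'I_s, path_indices (T l)} |
                    [forall l, path_end (T l) (indices (G l)) == Some [::]])
                \prod_(l < s)
                  path_weight #|F| (\dim (W l)) (T l) (indices (G l)))%N%:R
      :> rat.
Proof.
have [pi [irr co [e ann] dimW tabT]] := has_type_tables hT.
exists (size (cover_chains g (\dim {:vT}) 0%VS)); first exact: card_jordan_holder.
rewrite (size_cover_chainsE irr co ann tabT) ?dimv0 // /weight_formula.
congr (_ * _%:R).
(* The sum over tuples of sequences factors into one sum per table, which is [total_weight]. *)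
rewrite (@sum_dffun_prod _ (fun l => path_indices (T l))
  (fun l G => path_end (T l) (indices G) == Some [::])
  (fun l G => path_weight #|F| (\dim (W l)) (T l) (indices G))).
by apply: eq_bigr => l _; rewrite dimW -(sum_path_weight _ _ _ (leqnn _)).
Qed.
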